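(* Let $G$ be a subgroup of the symmetric group $S_m$, let $V$ and $U$ be unitary spaces, and let $\mathfrak{X}$ be an irreducible unitary representation of $G$ over $U$. For all $u,v\in U$ and $x^\times=(x_1,\dots,x_m)$, $y^\times=(y_1,\dots,y_m)\in \times^{m}V$ we have $$\left\langle C_{\mathfrak{X}}(u\otimes x^\times),\, v\otimes y^\times \right\rangle=\frac{1}{|G|}\langle Tr_{\mathfrak{X}}(A)u,v\rangle,$$ where $A=[a_{ij}]\in \mathbb{C}_{m\times m}$ is the matrix with $a_{ij}=\langle x_i,y_j\rangle$.
   Context: A unitary space is a finite-dimensional complex vector space equipped with an inner product (linear in the first argument). A unitary representation of $G$ over $U$ is a group homomorphism from $G$ to the unitary operators on $U$. $\times^{m}V$ denotes the Cartesian product of $m$ copies of $V$. The space $U\otimes\times^{m}V$ (tensor product over $\mathbb{C}$) carries the inner product determined by $\langle u\otimes x^\times, v\otimes y^\times\rangle=\langle u,v\rangle\sum_{i=1}^m\langle x_i,y_i\rangle$. For $\sigma\in G$, $Q(\sigma)(v_1,\dots,v_m)=(v_{\sigma^{-1}(1)},\dots,v_{\sigma^{-1}(m)})$ on $\times^m V$. The generalized Cartesian symmetrizer is $C_{\mathfrak{X}}=\frac{1}{|G|}\sum_{\sigma\in G}\mathfrak{X}(\sigma)\otimes Q(\sigma)$. The generalized trace function $Tr_{\mathfrak{X}}:\mathbb{C}_{m\times m}\to \mathrm{End}(U)$ is defined by $Tr_{\mathfrak{X}}(A)=\sum_{\sigma\in G}\Big(\sum_{i=1}^m a_{i\sigma(i)}\Big)\mathfrak{X}(\sigma)$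 for $A=(a_{ij})$. *)

(* Defs.v *)
From HB Require Import structures.
From mathcomp Require Import all_boot all_order all_fingroup all_algebra.
From mathcomp Require Import sesquilinear.
From mathcomp Require Import complex reals.

Set Implicit Arguments.
Unset Strict Implicit.
Unset Printing Implicit Defensive.

Import Order.TTheory GRing.Theory Num.Theory.
Local Open Scope ring_scope.

(* A unitary space is a [vectType C] together with a form
   [d : {dot U for Num.conj}], which is linear in its first argument. *)

(* The tensor product of finite-dimensional spaces, realized without
   coordinates as Hom(U^*, W), where [u (x) w] is the map [phi |-> phi(u) w].
   See [tens_universal] for the universal property. *)
Section TensorSpace.
Variables (F : fieldType) (U W : vectType F).

Definition tensor : Type := 'Hom('Hom(U, F^o), W).

HB.instance Definition _ := Vector.on tensor.

Definition tens (u : U) (w : W) : tensor :=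
  linfun (fun phi : 'Hom(U, F^o) => (phi u : F) *: w).

Definition dual_coord n (e : n.-tuple U) (i : 'I_n) : 'Hom(U, F^o) :=
  linfun (coord e i : U -> F^o).

End TensorSpace.

Notation "u '⊗' w" := (tens u w) (at level 40, left associativity) : ring_scope.

Section TensorTheory.
Variable F : fieldType.
Implicit Types U W T : vectType F.

Fact tens_sub_is_linear U W (u : U) (w : W) :
  linear (fun phi : 'Hom(U, F^o) => (phi u : F) *: w).
Proof. by move=> a f g; rewrite add_lfunE scale_lfunE scalerDl scalerA. Qed.

Lemma tensE U W (u : U) (w : W) (phi : 'Hom(U, F^o)) :
  (u ⊗ w : 'Hom('Hom(U, F^o), W)) phi = (phi u : F) *: w.
Proof.
pose L := GRing.isLinear.Build _ _ _ _ _ (tens_sub_is_linear u w).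
pose f : {linear 'Hom(U, F^o) -> W} :=
  HB.pack (fun phi : 'Hom(U, F^o) => (phi u : F) *: w) L.
exact: (lfunE f).
Qed.

Fact tens_is_bilinear U W : bilinear_for
  (GRing.Scale.Law.clone _ _ *:%R _) (GRing.Scale.Law.clone _ _ *:%R _)
  (@tens F U W).
Proof.
split=> [w|u] a x y /=; apply/lfunP=> phi.
  by rewrite add_lfunE scale_lfunE !tensE linearP scalerDl scalerA.
by rewrite add_lfunE scale_lfunE !tensE scalerDr !scalerA mulrC.
Qed.
HB.instance Definition _ U W :=
  bilinear_isBilinear.Build F U W (tensor U W) _ _ (@tens F U W)
    (tens_is_bilinear U W).

Lemma dual_coordE U n (e : n.-tuple U) i u : dual_coord e i u = coord e i u.
Proof. exact: lfunE. Qed.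

Lemma tens_basis U W n (e : n.-tuple U) (t : tensor U W) :
  basis_of fullv e -> t = \sum_(i < n) e`_i ⊗ (t : 'Hom(_, _)) (dual_coord e i).
Proof.
move=> eU; apply/lfunP=> phi; rewrite sum_lfunE.
rewrite (_ : phi = \sum_(i < n) (phi e`_i : F) *: dual_coord e i).
  rewrite linear_sum; apply: eq_bigr => i _.
  rewrite tensE linearZ; congr (_ *: _).
  rewrite sum_lfunE (bigD1 i) //= scale_lfunE dual_coordE.
  rewrite coord_free ?(basis_free eU) // eqxx big1 ?addr0 ?[_ *: _]mulr1 // => j ji.
  rewrite scale_lfunE dual_coordE coord_free ?(basis_free eU) //.
  by rewrite -val_eqE eq_sym val_eqE (negbTE ji) scaler0.
apply/lfunP=> u; rewrite sum_lfunE {1}(coord_basis eU (memvf u)) linear_sum.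
apply: eq_bigr => i _; rewrite scale_lfunE dual_coordE linearZ.
by rewrite [LHS]mulrC.
Qed.

Lemma tens_vbasis U W (t : tensor U W) :
  t = \sum_(i < \dim {:U}) (vbasis fullv)`_i ⊗ (t : 'Hom(_, _)) (dual_coord (vbasis fullv) i).
Proof. exact/tens_basis/vbasisP. Qed.

Lemma tens_ext U W T (f g : 'Hom(tensor U W, T)) :
  (forall u w, f (u ⊗ w) = g (u ⊗ w)) -> f = g.
Proof.
move=> fg; apply/lfunP=> t; rewrite (tens_vbasis t) !linear_sum.
by apply: eq_bigr => i _; apply: fg.
Qed.

Lemma tens_universal U W T (b : {bilinear U -> W -> T}) :
  exists! f : 'Hom(tensor U W, T), forall u w, f (u ⊗ w) = b u w.
Proof.
pose e := vbasis (@fullv F U).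
pose f0 (t : tensor U W) : T :=
  \sum_(i < \dim {:U}) b e`_i ((t : 'Hom(_, _)) (dual_coord e i)).
have f0L : linear f0.
  move=> a s t; rewrite /f0 scaler_sumr -big_split; apply: eq_bigr => i _ /=.
  by rewrite add_lfunE scale_lfunE linearPr.
pose L := GRing.isLinear.Build _ _ _ _ f0 f0L.
pose f : {linear tensor U W -> T} := HB.pack f0 L.
have fE u w : linfun f (u ⊗ w) = b u w.
  rewrite lfunE /= /f0 {2}(coord_vbasis (memvf u)) linear_sumlz.
  apply: eq_bigr => i _.
  by rewrite tensE dual_coordE linearZr linearZl_LR.
exists (linfun f); split=> // g gE; apply: tens_ext => u w.
by rewrite fE gE.
Qed.

End TensorTheory.

(* [f (x) g], i.e. [t |-> g \o t \o f^*] for [f^*] the transpose of [f]. *)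
Section TensorMap.
Variables (F : fieldType) (U W U' W' : vectType F).
Variables (f : 'Hom(U, U')) (g : 'Hom(W, W')).

Definition tens_map : 'Hom(tensor U W, tensor U' W') :=
  linfun (fun t : tensor U W =>
    (g \o ((t : 'Hom('Hom(U, F^o), W))
           \o linfun (fun phi : 'Hom(U', F^o) => (phi \o f)%VF)))%VF
    : tensor U' W').

Lemma tens_mapE u w : tens_map (u ⊗ w) = f u ⊗ g w.
Proof.
have L1 : linear (fun phi : 'Hom(U', F^o) => (phi \o f)%VF).
  by move=> a p q; rewrite comp_lfunDl comp_lfunZl.
pose M1 := GRing.isLinear.Build _ _ _ _ _ L1.
pose h : {linear 'Hom(U', F^o) -> 'Hom(U, F^o)} :=
  HB.pack (fun phi : 'Hom(U', F^o) => (phi \o f)%VF) M1.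
have L2 : linear (fun t : tensor U W =>
   (g \o ((t : 'Hom('Hom(U, F^o), W)) \o linfun h))%VF : tensor U' W').
  move=> a p q.
  by rewrite comp_lfunDl comp_lfunDr comp_lfunZr -!comp_lfunZl comp_lfunZr.
pose M2 := GRing.isLinear.Build _ _ _ _ _ L2.
pose k : {linear tensor U W -> tensor U' W'} := HB.pack (fun t : tensor U W =>
   (g \o ((t : 'Hom('Hom(U, F^o), W)) \o linfun h))%VF : tensor U' W') M2.
rewrite /tens_map (lfunE k); apply/lfunP=> phi.
by rewrite /= comp_lfunE comp_lfunE (lfunE h) /= !tensE linearZ comp_lfunE.
Qed.

End TensorMap.

Section InnerProducts.
Variable C : numClosedFieldType.

(* The inner product of [U (x) W]: writing [t] as [\sum_i e_i (x) t_i] on a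
   basis [e] of [U], it is the sum of the [<e_i, e_j> * <t_i, t'_j>].
   By [tens_vbasis], it is the only inner product satisfying [tens_dotE]. *)
Section TensorDot.
Variables (U W : vectType C) (dU : {dot U for Num.conj}) (dW : {dot W for Num.conj}).

Definition tens_dot (t t' : tensor U W) : C :=
  let e := vbasis (@fullv C U) in
  let c (s : tensor U W) i := (s : 'Hom('Hom(U, C^o), W)) (dual_coord e i) in
  \sum_(i < \dim {:U}) \sum_(j < \dim {:U}) dU e`_i e`_j * dW (c t i) (c t' j).

Fact tens_dot_is_bilinear : bilinear_for
  (GRing.Scale.Law.clone _ _ *%R _) (GRing.Scale.Law.clone _ _ (Num.conj \; *%R) _)
  tens_dot.
Proof.
split=> [t'|t] a x y /=; rewrite /tens_dot mulr_sumr -big_split;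
    apply: eq_bigr => i _ /=; rewrite mulr_sumr -big_split;
    apply: eq_bigr => j _ /=.
  by rewrite add_lfunE scale_lfunE linearDl linearZl_LR mulrDr mulrCA.
by rewrite add_lfunE scale_lfunE linearDr linearZr_LR mulrDr mulrCA.
Qed.
HB.instance Definition _ := bilinear_isBilinear.Build C (tensor U W) (tensor U W)
  C _ _ tens_dot tens_dot_is_bilinear.

Fact tens_dot_is_hermitian t t' :
  tens_dot t t' = (-1) ^+ false * (tens_dot t' t)^*.
Proof.
rewrite expr0 mul1r /tens_dot exchange_big rmorph_sum; apply: eq_bigr => i _.
rewrite rmorph_sum; apply: eq_bigr => j _; rewrite rmorphM.
by congr (_ * _); rewrite hermC expr0 mul1r.
Qed.
HB.instance Definition _ := isHermitianSesquilinear.Build C (tensor U W) false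
  Num.conj tens_dot tens_dot_is_hermitian.

Lemma tens_dotE u v w z : tens_dot (u ⊗ w) (v ⊗ z) = dU u v * dW w z.
Proof.
rewrite {2}(coord_vbasis (memvf u)) {2}(coord_vbasis (memvf v)).
rewrite linear_sumlz mulr_suml; apply: eq_bigr => i _.
rewrite linear_sumr mulr_suml; apply: eq_bigr => j _.
rewrite !tensE !dual_coordE linearZl_LR linearZr_LR linearZl_LR linearZr_LR /=.
by rewrite -!mulrA mulrCA; congr (_ * _); rewrite mulrCA.
Qed.

Lemma orthogonal_basis (X : seq U) :
  exists2 s : seq U, pairwise_orthogonal dU s & <<s>>%VS = <<X>>%VS.
Proof.
elim: X => [|x X [s os sX]]; first by exists [::].
have [y ys [z [xE _ zs]]] := orthogonal_split dU s x.
have sP a : (<[y + a]> + <<s>> = <[a]> + <<s>>)%VS.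
  apply/eqP; rewrite eqEsubv !subv_add !addvSr !andbT -!memvE; apply/andP; split.
    by rewrite addrC memv_add ?memv_line.
  by rewrite -{1}(addKr y a) addrC memv_add ?memv_line ?memvN.
have [z0|z0] := eqVneq z 0.
  exists s => //; rewrite span_cons -sX xE sP z0.
  by rewrite (_ : <[0]>%VS = 0%VS) ?add0v //; apply/eqP; rewrite -dimv_eq0 dim_vline eqxx.
exists (z :: s); last by rewrite !span_cons -sX xE sP.
by rewrite -cat1s pairwise_orthogonal_cat os zs /pairwise_orthogonal /= inE eq_sym z0.
Qed.

Fact tens_dot_gt0 (t : tensor U W) : t != 0 -> 0 < tens_dot t t.
Proof.
have [s os sU] := orthogonal_basis (vbasis (@fullv C U)).
have bU : basis_of fullv (in_tuple s).
  by rewrite /basis_of /= (orthogonal_free os) sU (span_basis (vbasisP _)) eqxx.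
pose c i := (t : 'Hom('Hom(U, C^o), W)) (dual_coord (in_tuple s) i).
have tE : t = \sum_(i < size s) s`_i ⊗ c i by exact: (tens_basis t bU).
have -> : tens_dot t t = \sum_(i < size s) dU s`_i s`_i * dW (c i) (c i).
  rewrite {1}tE linear_sumlz; apply: eq_bigr => i _.
  rewrite tE linear_sumr (bigD1 i) //= tens_dotE big1 ?addr0 // => j ji.
  have [/=/andP[s0 us] oss] := pairwise_orthogonalP os.
  by rewrite tens_dotE oss ?mul0r ?mem_nth // nth_uniq // eq_sym.
have ge0 (i : 'I_(size s)) : 0 <= dU s`_i s`_i * dW (c i) (c i) by rewrite mulr_ge0 ?dnorm_ge0.
rewrite lt_neqAle sumr_ge0 // andbT; apply: contra => /eqP/esym.
move/psumr_eq0P => H; rewrite tE; apply/eqP/big1 => i _.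
have /eqP := H (fun i _ => ge0 i) i isT.
rewrite mulf_eq0 !dnorm_eq0 => /orP[/eqP->|/eqP->]; last exact: linear0r.
exact: linear0l.
Qed.
HB.instance Definition _ := isDotProduct.Build C (tensor U W) tens_dot tens_dot_gt0.

End TensorDot.

Section CartesianPower.
Variables (m : nat) (V : vectType C) (dV : {dot V for Num.conj}).

(* The Cartesian power of [V] is [{ffun 'I_m -> V}]. *)
Definition cart_dot (x y : {ffun 'I_m -> V}) : C := \sum_i dV (x i) (y i).

Fact cart_dot_is_bilinear : bilinear_for
  (GRing.Scale.Law.clone _ _ *%R _) (GRing.Scale.Law.clone _ _ (Num.conj \; *%R) _)
  cart_dot.
Proof.
split=> [y|x] a z t /=; rewrite /cart_dot mulr_sumr -big_split;
  apply: eq_bigr => i _ /=; rewrite !ffunE.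
  by rewrite linearDl linearZl_LR.
by rewrite linearDr linearZr_LR.
Qed.
HB.instance Definition _ := bilinear_isBilinear.Build C {ffun 'I_m -> V}
  {ffun 'I_m -> V} C _ _ cart_dot cart_dot_is_bilinear.

Fact cart_dot_is_hermitian x y :
  cart_dot x y = (-1) ^+ false * (cart_dot y x)^*.
Proof.
rewrite expr0 mul1r /cart_dot rmorph_sum; apply: eq_bigr => i _.
by rewrite hermC expr0 mul1r.
Qed.
HB.instance Definition _ := isHermitianSesquilinear.Build C {ffun 'I_m -> V} false
  Num.conj cart_dot cart_dot_is_hermitian.

Fact cart_dot_gt0 (x : {ffun 'I_m -> V}) : x != 0 -> 0 < cart_dot x x.
Proof.
move=> x0; rewrite lt_neqAle sumr_ge0 => [|i _]; last exact: dnorm_ge0.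
rewrite andbT; apply: contra x0 => /eqP/esym/psumr_eq0P H; apply/eqP/ffunP=> i.
rewrite ffunE; apply/eqP; rewrite -(dnorm_eq0 dV) H // => j _; exact: dnorm_ge0.
Qed.
HB.instance Definition _ := isDotProduct.Build C {ffun 'I_m -> V} cart_dot
  cart_dot_gt0.

Definition cart_perm (s : 'S_m) : 'End({ffun 'I_m -> V}) :=
  linfun (fun x : {ffun 'I_m -> V} => [ffun i => x ((s^-1)%g i)]).

Lemma cart_permE s x i : cart_perm s x i = x ((s^-1)%g i).
Proof.
pose f0 (x : {ffun 'I_m -> V}) := [ffun i => x ((s^-1)%g i)].
have f0L : linear f0 by move=> a y z; apply/ffunP=> j; rewrite !ffunE.
pose L := GRing.isLinear.Build _ _ _ _ f0 f0L.
pose f : {linear {ffun 'I_m -> V} -> {ffun 'I_m -> V}} := HB.pack f0 L.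
by rewrite /cart_perm (lfunE f) /= ffunE.
Qed.

End CartesianPower.

Section UnitaryRepresentation.
Variables (m : nat) (G : {group 'S_m}).
Variables (U : vectType C) (dU : {dot U for Num.conj}).

(* As for [mx_representation], the values outside [G] are irrelevant.  In
   mathcomp [(s * t)%g i = t (s i)], so the composite "s after t" of two
   permutations is [(t * s)%g].  Since [U] is finite-dimensional, the isometries
   of [U] into itself are exactly its unitary operators. *)
Record unitary_repr := UnitaryRepr {
  unitary_repr_fun :> 'S_m -> 'End(U);
  unitary_repr1 : unitary_repr_fun 1%g = \1%VF;
  unitary_reprM : {in G &, forall s t,
    unitary_repr_fun (t * s)%g = (unitary_repr_fun s \o unitary_repr_fun t)%VF};
  unitary_repr_isometry : {in G, forall s, isometry dU dU (unitary_repr_fun s)}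
}.

Definition irreducible_repr (X : unitary_repr) : Prop :=
  ({:U} != 0)%VS /\
  forall W : {vspace U}, (forall s, s \in G -> (X s @: W <= W)%VS) ->
    W = 0%VS \/ W = fullv.

Definition cart_symmetrizer (V : vectType C) (X : unitary_repr) :
    'End(tensor U {ffun 'I_m -> V}) :=
  #|G|%:R^-1 *: \sum_(s in G) tens_map (X s) (cart_perm V s).

Definition gen_trace (X : unitary_repr) (A : 'M[C]_m) : 'End(U) :=
  \sum_(s in G) (\sum_i A i (s i)) *: X s.

End UnitaryRepresentation.
End InnerProducts.

Arguments cart_symmetrizer {C m G U dU} V X.

(* Main.v *)
Require Import Defs.
From HB Require Import structures.
From mathcomp Require Import all_boot all_order all_fingroup all_algebra.
From mathcomp Require Import sesquilinear.
From mathcomp Require Import complex reals.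

Set Implicit Arguments.
Unset Strict Implicit.
Unset Printing Implicit Defensive.

Import Order.TTheory GRing.Theory Num.Theory.
Local Open Scope ring_scope.

(** Both sides are averages over [G], and they agree term by term. On the left,
    [X s (x) Q s] sends [u (x) x] to [X s u (x) Q s x], and the inner product of
    this decomposable tensor with [v (x) y] is [<X s u, v> * <Q s x, y>]. The
    second factor is the scalar that the generalized trace attaches to [s]
    ([cart_dot_perm]): reindexing the sum moves the permutation from [x] to [y],
    which turns [<x (s^-1 i), y i>] into the entry [<x i, y (s i)>] of the Gram
    matrix. *)

(** The permutation moves across the inner product because the sum over the
    coordinates may be reindexed along [s]. *)
Lemma cart_dot_perm (C : numClosedFieldType) (m : nat) (V : vectType C)
    (dV : {dot V for Num.conj}) (s : 'S_m) (x y : {ffun 'I_m -> V}) :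
  cart_dot dV (cart_perm V s x) y = \sum_i dV (x i) (y (s i)).
Proof.
rewrite /cart_dot (reindex_inj (@perm_inj _ s)) /=.
by apply: eq_bigr => i _; rewrite cart_permE permK.
Qed.

Lemma cart_symmetrizer_tens (C : numClosedFieldType) (m : nat)
    (G : {group 'S_m}) (V U : vectType C) (dU : {dot U for Num.conj})
    (X : unitary_repr G dU) (u : U) (x : {ffun 'I_m -> V}) :
  cart_symmetrizer V X (u ⊗ x)
    = #|G|%:R^-1 *: \sum_(s in G) X s u ⊗ cart_perm V s x.
Proof.
rewrite /cart_symmetrizer scale_lfunE sum_lfunE.
by congr (_ *: _); apply: eq_bigr => s _; rewrite tens_mapE.
Qed.

Theorem theorem1p4 (R : realType) (m : nat) (G : {group 'S_m})
    (V U : vectType R[i])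
    (dV : {dot V for Num.conj}) (dU : {dot U for Num.conj})
    (X : unitary_repr G dU) (irrX : irreducible_repr X)
    (u v : U) (x y : {ffun 'I_m -> V}) :
  let A : 'M[R[i]]_m := \matrix_(i, j) dV (x i) (y j) in
  tens_dot dU (cart_dot dV) (cart_symmetrizer V X (u ⊗ x)) (v ⊗ y)
    = #|G|%:R^-1 * dU (gen_trace X A u) v.
Proof.
move=> A; rewrite cart_symmetrizer_tens linearZl_LR; congr (_ * _).
rewrite linear_sumlz /gen_trace sum_lfunE linear_sumlz.
apply: eq_bigr => s _; rewrite scale_lfunE linearZl_LR /= tens_dotE /= cart_dot_perm.
by rewrite mulrC; congr (_ * _); apply: eq_bigr => i _; rewrite mxE.
Qed.
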